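(* Let $M$ be a smooth odd-dimensional manifold and let $(\mathcal Z,\xi,\pi,\sigma,F)$ be an (integrable) generalized para-contact structure on $M$, with associated endomorphism $\mathcal F$ of $TM\oplus TM^*$ and associated bundles $L=L_{\mathcal Z}\oplus E^{(1,0)}$ and $L^*=L_\xi\oplus E^{(0,1)}$. Then the pair $(L,L^* )$ forms a Lie bialgebroid if and only if $d\xi$ is of type $(1,1)$ with respect to the map $\mathcal F$ on $\Gamma((\ker\mathcal Z\oplus\ker\xi)_{\mathbb C})$.
   Context: $TM\oplus TM^*$ carries the pairing $\langle X+\alpha,Y+\beta\rangle=\frac12(i_X\beta+i_Y\alpha)$ and the Courant bracket $$\llbracket (X,\alpha),(Y,\beta)\rrbracket=[X,Y]+L_X\beta-L_Y\alpha-\tfrac12 d(i_X\beta-i_Y\alpha).$$ For a bivector field $\pi$ and a 2-form $\sigma$: $\beta(\pi^\sharp\alpha)=\pi(\alpha,\beta)$, $\sigma_\sharp(X)(Y)=\sigma(X,Y)$. A generalized almost para-contact structure on $M$, represented by $(\mathcal Z,\xi,\pi,\sigma,F)$, consists of a bundle endomorphism $\mathcal F=\begin{pmatrix}F&\pi^\sharp\\ \sigma_\sharp&-F^*\end{pmatrix}$ of $TM\oplus TM^*$ ($F:TM\to TM$ a bundle map, $F^*$ its dual) and a section $\mathcal Z+\xi$ of $TM\oplus TM^*$ such that $\mathcal F+\mathcal F^*=0$ (adjoint with respect to $\langle\,,\rangle$), $\xi(\mathcal Z)=1$, $\mathcal F(\xi)=0$, $\mathcal F(\mathcal Z)=0$,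 $\mathcal F^2=\mathcal I-\mathcal Z\odot\xi$, where $(\mathcal Z\odot\xi)(X+\alpha)=\xi(X)\mathcal Z+\alpha(\mathcal Z)\xi$. The subscript $\mathbb C$ denotes paracomplexification, i.e. tensoring with the para-complex numbers $\mathbb R[e]$, $e^2=1$; $\mathcal F$, $\langle\,,\rangle$ and $\llbracket\,,\rrbracket$ are extended para-complex (bi)linearly. $\ker\xi\subset TM$ and $\ker\mathcal Z\subset TM^*$ are the pointwise kernels of $\xi$ and of evaluation on $\mathcal Z$. $L_{\mathcal Z}$ and $L_\xi$ are the line bundles spanned by $\mathcal Z$ and $\xi$ (paracomplexified as subbundles of $(TM\oplus TM^* )_{\mathbb C}$), and $$E^{(1,0)}=\{\mathcal X+e\mathcal F\mathcal X\},\qquad E^{(0,1)}=\{\mathcal X-e\mathcal F\mathcal X\},\qquad \mathcal X\in\Gamma(\ker\mathcal Z\oplus\ker\xi).$$ Put $L=L_{\mathcal Z}\oplus E^{(1,0)}$, $L^*=L_\xi\oplus E^{(0,1)}$. The structure is called a generalized para-contact structure if $\Gamma(L)$ is closed under the Courant bracket. Let $\rho:(TM\oplus TM^* )_{\mathbb C}\to TM_{\mathbb C}$ be the natural projection (anchor). ''$d\xi$ is of type $(1,1)$ with respect to $\mathcal F$'' means that $\rho^*(d\xi)$ restricted to $(\ker\mathcal Z\oplus\ker\xi)_{\mathbb C}=E^{(1,0)}\oplus E^{(0,1)}$ has vanishing $(2,0)$ and $(0,2)$ components, i.e. $d\xi(\rho(A),\rho(B))=0$ whenever $A,B$ are both sections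 of $E^{(1,0)}$ or both sections of $E^{(0,1)}$. A Lie algebroid is a vector bundle $A\to M$ with anchor $\rho_A:A\to TM$ and a Lie bracket $[\,,]_A$ on $\Gamma(A)$ satisfying $[\alpha,f\beta]_A=f[\alpha,\beta]_A+L_{\rho_A(\alpha)}(f)\beta$. If $A$ and its dual $A^*$ are both Lie algebroids, $(A,A^* )$ is a Lie bialgebroid if $d_*[X,Y]=L_Xd_*Y-L_Yd_*X$ for $X,Y\in\Gamma(A)$, where $d_*$ is the exterior derivative associated to $A^*$. Here these notions are taken in the paracomplexified sense, $L^*$ is identified with the dual of $L$ via the pairing, and the brackets and anchors on $L$ and $L^*$ are the restrictions of the Courant bracket and of $\rho$. *)

(* Defs.v *)
From HB Require Import structures.
From mathcomp Require Import all_boot all_order all_algebra.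
From mathcomp Require Import all_classical all_reals all_analysis.
Set Implicit Arguments.
Unset Strict Implicit.
Unset Printing Implicit Defensive.
From mathcomp Require Import ring.
Import Order.TTheory GRing.Theory Num.Theory.
Import numFieldNormedType.Exports.
Local Open Scope classical_set_scope.
Local Open Scope ring_scope.

Section SmoothEuclidean.
Context {R : realType} {n : nat}.
Implicit Types (U : set 'rV[R]_n) (f g : 'rV[R]_n -> R).

Fixpoint Ck_on (k : nat) U f : Prop :=
  match k with
  | 0%N => forall x, U x -> {for x, continuous f}
  | k'.+1 => (forall x, U x -> {for x, continuous f}) /\
      forall i : 'I_n, (forall x, U x -> derivable f x (delta_mx ord0 i)) /\
        Ck_on k' U (fun x => 'D_(delta_mx ord0 i) f x)
  end.

Definition smooth_on U f := forall k, Ck_on k U f.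

Lemma Ck_onS k U f : Ck_on k.+1 U f -> Ck_on k U f.
Proof.
elim: k f => [|k IH] f /=; first by case.
by move=> [cf df]; split=> // i; have [d1 d2] := df i; split=> //; exact: IH.
Qed.

Lemma Ck_on_ext k U f g : open U -> (forall x, U x -> f x = g x) ->
  Ck_on k U f -> Ck_on k U g.
Proof.
move=> oU; have near_eq h h' x : (forall x, U x -> h x = h' x) -> U x ->
    \forall y \near x, h y = h' y :> R.
  by move=> hh' Ux; near=> y; apply: hh'; near: y; exact: open_nbhs_nbhs.
have cont h h' : (forall x, U x -> h x = h' x) ->
    (forall x, U x -> {for x, continuous h}) ->
    forall x, U x -> {for x, continuous (h' : 'rV[R]_n -> R)}.
  move=> hh' ch x Ux; have := ch x Ux; rewrite /prop_for /continuous_at -hh'//.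
  by apply: cvg_trans; exact: (near_eq_cvg (near_eq _ _ _ hh' Ux)).
elim: k f g => [|k IH] f g fg /=; first exact: cont.
move=> [cf df]; split; first exact: cont cf.
move=> i; have [d1 d2] := df i; split.
  by move=> x Ux; apply: near_eq_derivable (d1 x Ux); exact: (near_eq _ _ _ fg Ux).
by apply: IH d2 => x Ux; apply: near_eq_derive; exact: (near_eq _ _ _ fg Ux).
Unshelve. all: by end_near. Qed.

Lemma Ck_on_cst k U c : Ck_on k U (cst c).
Proof.
elim: k c => [|k IH] c /=; first by move=> x _; exact: cst_continuous.
split; first by move=> x _; exact: cst_continuous.
move=> i; split; first by move=> x _; exact: derivable_cst.
rewrite (_ : (fun x => _) = cst 0); first exact: IH.
by apply/funext => x; rewrite derive_cst.
Qed.

Lemma Ck_onD k U f g : open U -> Ck_on k U f -> Ck_on k U g -> Ck_on k U (f + g).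
Proof.
move=> oU; elim: k f g => [|k IH] f g /=.
  by move=> cf cg x Ux; exact: (continuousD (cf x Ux) (cg x Ux)).
move=> [cf df] [cg dg]; split.
  by move=> x Ux; exact: (continuousD (cf x Ux) (cg x Ux)).
move=> i; have [f1 f2] := df i; have [g1 g2] := dg i; split.
  by move=> x Ux; apply: derivableD; [exact: f1|exact: g1].
apply: Ck_on_ext (IH _ _ f2 g2) => // x Ux.
by rewrite deriveD//; [exact: f1|exact: g1].
Qed.

Lemma Ck_onM k U f g : open U -> Ck_on k U f -> Ck_on k U g -> Ck_on k U (f * g).
Proof.
move=> oU; elim: k f g => [|k IH] f g.
  by move=> cf cg x Ux; exact: (continuousM (cf x Ux) (cg x Ux)).
move=> Cf Cg; have Cf' := Ck_onS Cf; have Cg' := Ck_onS Cg.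
case: Cf => cf df; case: Cg => cg dg; split.
  by move=> x Ux; exact: (continuousM (cf x Ux) (cg x Ux)).
move=> i; have [f1 f2] := df i; have [g1 g2] := dg i; split.
  by move=> x Ux; apply: derivableM; [exact: f1|exact: g1].
apply: Ck_on_ext (Ck_onD oU (IH _ _ Cf' g2) (IH _ _ Cg' f2)) => // x Ux.
by rewrite deriveM//; [exact: f1|exact: g1].
Qed.

End SmoothEuclidean.

(* [cmap] and [cinv] are total functions; only their values on [dom] and on
   the image of [dom] matter. *)
Record chart (R : realType) (n : nat) (T : topologicalType) := Chart {
  dom : set T;
  cmap : T -> 'rV[R]_n;
  cinv : 'rV[R]_n -> T;
  dom_open : open dom;
  im_open : open (cmap @` dom);
  cmapK : forall p, dom p -> cinv (cmap p) = p;
  cmap_cont : forall p, dom p -> {for p, continuous cmap};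
  cinv_cont : forall x, (cmap @` dom) x -> {for x, continuous cinv} }.

Arguments dom_open {R n T} c.
Arguments im_open {R n T} c.

(* The atlas need not be maximal. *)
Record smooth_manifold (R : realType) (n : nat) := SmoothManifold {
  carrier :> topologicalType;
  carrier_hausdorff : hausdorff_space carrier;
  carrier_second_countable : @second_countable carrier;
  atlas : set (chart R n carrier);
  atlas_cover : forall p : carrier, exists2 c, atlas c & dom c p;
  atlas_smooth : forall c c', atlas c -> atlas c' -> forall j : 'I_n,
    smooth_on (cmap c @` (dom c `&` dom c'))
              (fun x => cmap c' (cinv c x) ord0 j) }.

Section SmoothFunctions.
Context {R : realType} {n : nat} (M : smooth_manifold R n).

Definition smooth (f : M -> R) :=
  forall c, atlas c -> smooth_on (cmap c @` dom c) (f \o cinv c).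

Definition smooth_pred : {pred (M -> R)} := fun f => `[< smooth f >].

Record smoothfun := Smoothfun {
  smoothfun_val :> M -> R;
  smoothfunP : smoothfun_val \in smooth_pred }.

HB.instance Definition _ := [isSub for smoothfun_val].
HB.instance Definition _ := [Choice of smoothfun by <:].

Lemma smooth_cst c : cst c \in smooth_pred.
Proof. by apply/asboolP => a _ k; exact: Ck_on_cst. Qed.

Lemma smooth_subring : subring_closed smooth_pred.
Proof.
have smoothM f g : f \in smooth_pred -> g \in smooth_pred ->
    f * g \in smooth_pred.
  move=> /asboolP sf /asboolP sg; apply/asboolP => a aA k.
  exact: (Ck_onM (im_open a) (sf a aA k) (sg a aA k)).
split=> //; first exact: smooth_cst.
move=> f g sf sg; rewrite -mulN1r.
have /asboolP sNg : -1 * g \in smooth_pred by apply: smoothM sg; exact: (smooth_cst (-1)).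
move/asboolP: sf => sf; apply/asboolP => a aA k.
exact: (Ck_onD (im_open a) (sf a aA k) (sNg a aA k)).
Qed.

HB.instance Definition _ := GRing.SubChoice_isSubComPzRing.Build
  (M -> R) smooth_pred smoothfun smooth_subring.

Definition scst (c : R) : smoothfun := Smoothfun (smooth_cst c).

End SmoothFunctions.

(* Vector fields (sections of TM) are the R-linear derivations of C^oo(M),
   and one-forms (sections of T^*M) are the C^oo(M)-linear maps from vector
   fields to functions; bundle maps are C^oo(M)-linear maps of sections. *)
Definition derivation {R : realType} {n : nat} {M : smooth_manifold R n}
    (D : smoothfun M -> smoothfun M) : Prop :=
  [/\ forall f g, D (f + g) = D f + D g,
      forall c f, D (scst M c * f) = scst M c * D f
    & forall f g, D (f * g) = f * D g + D f * g].

Record vfield {R : realType} {n : nat} (M : smooth_manifold R n) := Vfield {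
  vact :> smoothfun M -> smoothfun M;
  vactP : derivation vact }.

Section VectorFields.
Context {R : realType} {n : nat} {M : smooth_manifold R n}.
Local Notation A := (smoothfun M).
Local Notation vf := (vfield M).
Implicit Types (X Y Z : vf) (a b f g : A).

HB.instance Definition _ := gen_eqMixin vf.
HB.instance Definition _ := gen_choiceMixin vf.

Lemma vfieldP X Y : (forall f, X f = Y f) -> X = Y.
Proof.
case: X Y => [x x1] [y y1] /= /funext xy.
by subst y; congr Vfield; exact: Prop_irrelevance.
Qed.

Lemma vactD X f g : X (f + g) = X f + X g.
Proof. by have [-> _ _] := vactP X. Qed.
Lemma vactZ X c f : X (scst M c * f) = scst M c * X f.
Proof. by have [_ -> _] := vactP X. Qed.
Lemma vactM X f g : X (f * g) = f * X g + X f * g.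
Proof. by have [_ _ ->] := vactP X. Qed.
Lemma vact0 X : X 0 = 0.
Proof. by apply: (addrI (X 0)); rewrite -vactD !addr0. Qed.
Lemma vactN X f : X (- f) = - X f.
Proof. by apply: (addrI (X f)); rewrite -vactD !subrr vact0. Qed.

Fact vf_zero_subproof : derivation (fun _ : A => 0 : A).
Proof. by split=> *; rewrite ?mulr0 ?mul0r ?addr0. Qed.
Fact vf_opp_subproof X : derivation (fun f => - X f).
Proof.
by split=> *; rewrite ?vactD ?vactZ ?vactM ?opprD ?mulrN ?mulNr.
Qed.
Fact vf_add_subproof X Y : derivation (fun f => X f + Y f).
Proof. by split=> *; rewrite ?vactD ?vactZ ?vactM; ring. Qed.
Fact vf_scale_subproof a X : derivation (fun f => a * X f).
Proof. by split=> *; rewrite ?vactD ?vactZ ?vactM; ring. Qed.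
Fact vf_bracket_subproof X Y : derivation (fun f => X (Y f) - Y (X f)).
Proof. by split=> *; rewrite ?(vactD, vactZ, vactM); ring. Qed.

Definition vf_zero : vf := Vfield vf_zero_subproof.
Definition vf_opp X : vf := Vfield (vf_opp_subproof X).
Definition vf_add X Y : vf := Vfield (vf_add_subproof X Y).
Definition vf_scale a X : vf := Vfield (vf_scale_subproof a X).

Fact vf_addA : associative vf_add.
Proof. by move=> X Y Z; apply: vfieldP => f /=; rewrite addrA. Qed.
Fact vf_addC : commutative vf_add.
Proof. by move=> X Y; apply: vfieldP => f /=; rewrite addrC. Qed.
Fact vf_add0 : left_id vf_zero vf_add.
Proof. by move=> X; apply: vfieldP => f /=; rewrite add0r. Qed.
Fact vf_addN : left_inverse vf_zero vf_opp vf_add.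
Proof. by move=> X; apply: vfieldP => f /=; rewrite addNr. Qed.
HB.instance Definition _ :=
  GRing.isZmodule.Build vf vf_addA vf_addC vf_add0 vf_addN.

Fact vf_scaleA a b X : vf_scale a (vf_scale b X) = vf_scale (a * b) X.
Proof. by apply: vfieldP => f /=; rewrite mulrA. Qed.
Fact vf_scale1 : left_id 1 vf_scale.
Proof. by move=> X; apply: vfieldP => f /=; rewrite mul1r. Qed.
Fact vf_scaleDr : right_distributive vf_scale +%R.
Proof. by move=> a X Y; apply: vfieldP => f /=; rewrite mulrDr. Qed.
Fact vf_scaleDl X : {morph vf_scale^~ X : a b / a + b}.
Proof. by move=> a b; apply: vfieldP => f /=; rewrite mulrDl. Qed.
HB.instance Definition _ := GRing.Zmodule_isLmodule.Build A vf
  vf_scaleA vf_scale1 vf_scaleDr vf_scaleDl.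

Definition vf_bracket X Y : vf := Vfield (vf_bracket_subproof X Y).

Lemma vf_bracketE X Y f : vf_bracket X Y f = X (Y f) - Y (X f).
Proof. by []. Qed.

Lemma vf_bracketDr X Y Z f :
  vf_bracket X (f *: Y + Z) = f *: vf_bracket X Y + X f *: Y + vf_bracket X Z.
Proof.
by apply: vfieldP => g; rewrite /= ?(vactD, vactM); ring.
Qed.

Lemma vf_bracketC X Y : vf_bracket X Y = - vf_bracket Y X.
Proof. by apply: vfieldP => g /=; rewrite opprB. Qed.

End VectorFields.

Record oneform {R : realType} {n : nat} (M : smooth_manifold R n) := Oneform {
  oact :> vfield M -> smoothfun M;
  oact_linear : forall f X Y, oact (f *: X + Y) = f * oact X + oact Y }.

Record altform (A : comPzRingType) (V : lmodType A) := Altform {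
  aform :> V -> V -> A;
  aform_linearl : forall a u v w, aform (a *: u + v) w = a * aform u w + aform v w;
  aform_linearr : forall a u v w, aform w (a *: u + v) = a * aform w u + aform w v;
  aform_alt : forall u, aform u u = 0 }.

Section OneForms.
Context {R : realType} {n : nat} {M : smooth_manifold R n}.
Local Notation A := (smoothfun M).
Local Notation vf := (vfield M).
Local Notation form1 := (oneform M).
Implicit Types (X Y Z : vf) (a b f g : A) (u v w : form1).

HB.instance Definition _ := gen_eqMixin form1.
HB.instance Definition _ := gen_choiceMixin form1.

Lemma oneformP u v : (forall X, u X = v X) -> u = v.
Proof.
case: u v => [x x1] [y y1] /= /funext xy.
by subst y; congr Oneform; exact: Prop_irrelevance.
Qed.

Lemma oact0 u : u 0 = 0.
Proof.
have := oact_linear u 0 0 0; rewrite scale0r addr0 mul0r add0r => _.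
have := oact_linear u 1 0 0; rewrite scale1r addr0 mul1r.
by move/(congr1 (fun x => x - u 0)); rewrite subrr addrK => <-.
Qed.
Lemma oactD u X Y : u (X + Y) = u X + u Y.
Proof. by have := oact_linear u 1 X Y; rewrite scale1r mul1r. Qed.
Lemma oactZ u f X : u (f *: X) = f * u X.
Proof. by have := oact_linear u f X 0; rewrite oact0 !addr0. Qed.
Lemma oactN u X : u (- X) = - u X.
Proof. by apply: (addrI (u X)); rewrite -oactD !subrr oact0. Qed.

Definition of_zero : form1.
Proof. by exists (fun=> 0) => *; rewrite mulr0 addr0. Defined.
Definition of_opp u : form1.
Proof. by exists (fun X => - u X) => *; rewrite oact_linear; ring. Defined.
Definition of_add u v : form1.
Proof. by exists (fun X => u X + v X) => *; rewrite !oact_linear; ring. Defined.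
Definition of_scale a u : form1.
Proof. by exists (fun X => a * u X) => *; rewrite !oact_linear; ring. Defined.

Fact of_addA : associative of_add.
Proof. by move=> u v w; apply: oneformP => X /=; rewrite addrA. Qed.
Fact of_addC : commutative of_add.
Proof. by move=> u v; apply: oneformP => X /=; rewrite addrC. Qed.
Fact of_add0 : left_id of_zero of_add.
Proof. by move=> u; apply: oneformP => X /=; rewrite add0r. Qed.
Fact of_addN : left_inverse of_zero of_opp of_add.
Proof. by move=> u; apply: oneformP => X /=; rewrite addNr. Qed.
HB.instance Definition _ :=
  GRing.isZmodule.Build form1 of_addA of_addC of_add0 of_addN.

Fact of_scaleA a b u : of_scale a (of_scale b u) = of_scale (a * b) u.
Proof. by apply: oneformP => X /=; rewrite mulrA. Qed.
Fact of_scale1 : left_id 1 of_scale.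
Proof. by move=> u; apply: oneformP => X /=; rewrite mul1r. Qed.
Fact of_scaleDr : right_distributive of_scale +%R.
Proof. by move=> a u v; apply: oneformP => X /=; rewrite mulrDr. Qed.
Fact of_scaleDl u : {morph of_scale^~ u : a b / a + b}.
Proof. by move=> a b; apply: oneformP => X /=; rewrite mulrDl. Qed.
HB.instance Definition _ := GRing.Zmodule_isLmodule.Build A form1
  of_scaleA of_scale1 of_scaleDr of_scaleDl.

Fact diff0_subproof f a X Y : (a *: X + Y) f = a * X f + Y f.
Proof. by []. Qed.
Definition diff0 f : form1 :=
  @Oneform R n M (fun X => X f) (diff0_subproof f).

Fact lieD_subproof X u f Y Z :
  X (u (f *: Y + Z)) - u (vf_bracket X (f *: Y + Z)) =
  f * (X (u Y) - u (vf_bracket X Y)) + (X (u Z) - u (vf_bracket X Z)).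
Proof.
rewrite vf_bracketDr !oactD !oactZ vactD vactM; ring.
Qed.
Definition lieD X u : form1 :=
  @Oneform R n M (fun Y => X (u Y) - u (vf_bracket X Y)) (lieD_subproof X u).

(* d u (X, Y) = X u(Y) - Y u(X) - u([X, Y]), with no factor 1/2. *)
Definition diff1_fun u X Y : A := X (u Y) - Y (u X) - u (vf_bracket X Y).

Fact diff1_linearr u a X Y Z :
  diff1_fun u Z (a *: X + Y) = a * diff1_fun u Z X + diff1_fun u Z Y.
Proof.
rewrite /diff1_fun vf_bracketDr !oactD !oactZ vactD vactM /=; ring.
Qed.
Fact diff1C u X Y : diff1_fun u X Y = - diff1_fun u Y X.
Proof. rewrite /diff1_fun vf_bracketC oactN; ring. Qed.
Fact diff1_linearl u a X Y Z :
  diff1_fun u (a *: X + Y) Z = a * diff1_fun u X Z + diff1_fun u Y Z.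
Proof. by rewrite diff1C diff1_linearr !(diff1C u _ Z); ring. Qed.
Fact diff1_alt u X : diff1_fun u X X = 0.
Proof.
rewrite /diff1_fun subrr sub0r (_ : vf_bracket X X = 0) ?oact0 ?oppr0//.
by apply: vfieldP => f /=; rewrite subrr.
Qed.
Definition diff1 u : altform (vfield M) := 
  @Altform A vf (diff1_fun u) (diff1_linearl u) (diff1_linearr u) (diff1_alt u).

End OneForms.

Section Tensors.
Context {R : realType} {n : nat} (M : smooth_manifold R n).

Definition twoform := altform (vfield M).

(* The form [biv] is the pairing of the section of Lambda^2 TM with pairs of
   one-forms, [biv_sharp] is the associated bundle map from T^*M to TM. *)
Record bivector := Bivector {
  biv :> altform (oneform M);
  biv_sharp : oneform M -> vfield M;
  biv_sharpE : forall a b : oneform M, b (biv_sharp a) = biv a b }.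

End Tensors.

(* The paracomplexification V[e], with e^2 = 1; [Pc u v] stands for u + e v. *)
Record pcx (V : Type) := Pc { pre : V; pim : V }.

HB.instance Definition _ (V : Type) := gen_eqMixin (pcx V).
HB.instance Definition _ (V : Type) := gen_choiceMixin (pcx V).

Lemma pcxP (V : Type) (x y : pcx V) : pre x = pre y -> pim x = pim y -> x = y.
Proof. by case: x y => [a b] [c d] /= -> ->. Qed.

Definition pc_real {V : zmodType} (u : V) : pcx V := Pc u 0.

Definition pc_map {U V : Type} (h : U -> V) (x : pcx U) : pcx V :=
  Pc (h (pre x)) (h (pim x)).

Definition pc_map2 {U V : Type} {W : zmodType} (h : U -> V -> W)
    (x : pcx U) (y : pcx V) : pcx W :=
  Pc (h (pre x) (pre y) + h (pim x) (pim y))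
     (h (pre x) (pim y) + h (pim x) (pre y)).

Section PcxZmodule.
Context {V : zmodType}.
Implicit Types x y z : pcx V.

Definition pc_add x y := Pc (pre x + pre y) (pim x + pim y).
Definition pc_opp x := Pc (- pre x) (- pim x).
Fact pc_addA : associative pc_add.
Proof. by move=> x y z; apply: pcxP; rewrite /= addrA. Qed.
Fact pc_addC : commutative pc_add.
Proof. by move=> x y; apply: pcxP; rewrite /= addrC. Qed.
Fact pc_add0 : left_id (Pc 0 0) pc_add.
Proof. by move=> x; apply: pcxP; rewrite /= add0r. Qed.
Fact pc_addN : left_inverse (Pc 0 0) pc_opp pc_add.
Proof. by move=> x; apply: pcxP; rewrite /= addNr. Qed.
HB.instance Definition _ :=
  GRing.isZmodule.Build (pcx V) pc_addA pc_addC pc_add0 pc_addN.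

End PcxZmodule.

Section PcxRing.
Context {A : comPzRingType}.
Implicit Types x y z : pcx A.

Definition pc_mul : pcx A -> pcx A -> pcx A := pc_map2 *%R.
Fact pc_mulA : associative pc_mul.
Proof. by move=> x y z; apply: pcxP => /=; ring. Qed.
Fact pc_mulC : commutative pc_mul.
Proof. by move=> x y; apply: pcxP => /=; ring. Qed.
Fact pc_mul1 : left_id (Pc 1 0) pc_mul.
Proof. by move=> x; apply: pcxP => /=; ring. Qed.
Fact pc_mulDl : left_distributive pc_mul +%R.
Proof. by move=> x y z; apply: pcxP => /=; ring. Qed.
HB.instance Definition _ := GRing.Zmodule_isComPzRing.Build (pcx A)
  pc_mulA pc_mulC pc_mul1 pc_mulDl.

Context {V : lmodType A}.
Implicit Types u v : pcx V.

Definition pc_scale : pcx A -> pcx V -> pcx V := pc_map2 *:%R.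
Fact pc_scaleA x y u : pc_scale x (pc_scale y u) = pc_scale (x * y) u.
Proof.
apply: pcxP; rewrite /= !scalerDr !scalerA !scalerDl -!addrA;
  by congr (_ + _); rewrite addrCA addrC -!addrA [RHS]addrCA addrC -!addrA.
Qed.
Fact pc_scale1 : left_id 1 pc_scale.
Proof. by move=> u; apply: pcxP; rewrite /= !scale1r !scale0r addr0. Qed.
Fact pc_scaleDr : right_distributive pc_scale +%R.
Proof. by move=> x u v; apply: pcxP; rewrite /= !scalerDr addrACA. Qed.
Fact pc_scaleDl u : {morph pc_scale^~ u : x y / x + y}.
Proof. by move=> x y; apply: pcxP; rewrite /= !scalerDl addrACA. Qed.
HB.instance Definition _ := GRing.Zmodule_isLmodule.Build (pcx A) (pcx V)
  pc_scaleA pc_scale1 pc_scaleDr pc_scaleDl.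

End PcxRing.

Section LieAlgebroids.
Context {R : realType} {n : nat} {M : smooth_manifold R n}.
Local Notation C := (pcx (smoothfun M)).

Definition pc_cst (c : pcx R) : C := pc_map (scst M) c.

Definition vact_pc : pcx (vfield M) -> C -> C := pc_map2 (@vact R n M).

(* A vector bundle is given by its module of sections, here a submodule [S]
   of an ambient module [E]; the bracket and the anchor are only used on [S]. *)
Record lie_algebroid {E : lmodType C} (S : set E) (br : E -> E -> E)
    (rho : E -> pcx (vfield M)) : Prop := {
  la_zero : S 0;
  la_submod : forall f x y, S x -> S y -> S (f *: x + y);
  la_anchor : forall f x y, S x -> S y -> rho (f *: x + y) = f *: rho x + rho y;
  la_closed : forall x y, S x -> S y -> S (br x y);
  la_bilinearl : forall c x y z, S x -> S y -> S z ->
    br (pc_cst c *: x + y) z = pc_cst c *: br x z + br y z;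
  la_bilinearr : forall c x y z, S x -> S y -> S z ->
    br z (pc_cst c *: x + y) = pc_cst c *: br z x + br z y;
  la_alt : forall x, S x -> br x x = 0;
  la_jacobi : forall x y z, S x -> S y -> S z ->
    br x (br y z) + br y (br z x) + br z (br x y) = 0;
  la_leibniz : forall f x y, S x -> S y ->
    br x (f *: y) = f *: br x y + vact_pc (rho x) f *: y }.

Section Bialgebroid.
Context {E E' : lmodType C}.
Context (S : set E) (br : E -> E -> E) (rho : E -> pcx (vfield M)).
Context (S' : set E') (br' : E' -> E' -> E') (rho' : E' -> pcx (vfield M)).
(* [S'] is regarded as the dual of [S] through [dual]. *)
Context (dual : E -> E' -> C).

Record dual_pairing : Prop := {
  dp_linearl : forall f x y a, S x -> S y -> S' a ->
    dual (f *: x + y) a = f * dual x a + dual y a;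
  dp_linearr : forall f a b x, S' a -> S' b -> S x ->
    dual x (f *: a + b) = f * dual x a + dual x b;
  dp_nondegl : forall x, S x -> (forall a, S' a -> dual x a = 0) -> x = 0;
  dp_nondegr : forall a, S' a -> (forall x, S x -> dual x a = 0) -> a = 0 }.

Definition cochain_diff (phi : E' -> C) (a b : E') : C :=
  vact_pc (rho' a) (phi b) - vact_pc (rho' b) (phi a) - phi (br' a b).

(* d_* x as a section of Lambda^2 S, that is, a 2-form on [S']. *)
Definition dstar (x : E) : E' -> E' -> C := cochain_diff (dual x).

(* L_x a for [a] in the dual: the section b of [S'] determined by
   <y, b> = rho(x) <y, a> - <[x, y], a>. *)
Definition dual_lie (x : E) (a : E') : E' :=
  xget 0 [set b | S' b /\ forall y, S y ->
    dual y b = vact_pc (rho x) (dual y a) - dual (br x y) a].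

Definition lie_bivec (x : E) (P : E' -> E' -> C) (a b : E') : C :=
  vact_pc (rho x) (P a b) - P (dual_lie x a) b - P a (dual_lie x b).

Record lie_bialgebroid : Prop := {
  lb_left : lie_algebroid S br rho;
  lb_right : lie_algebroid S' br' rho';
  lb_dual : dual_pairing;
  lb_compat : forall x y a b, S x -> S y -> S' a -> S' b ->
    dstar (br x y) a b =
      lie_bivec x (dstar y) a b - lie_bivec y (dstar x) a b }.

End Bialgebroid.
End LieAlgebroids.

Section Courant.
Context {R : realType} {n : nat} {M : smooth_manifold R n}.
Local Notation A := (smoothfun M).
Local Notation gsec := (vfield M * oneform M)%type.
Implicit Types x y : gsec.

Definition gpair x y : A := scst M 2^-1 * (y.2 x.1 + x.2 y.1).

Definition courant x y : gsec :=
  (vf_bracket x.1 y.1,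
   lieD x.1 y.2 - lieD y.1 x.2 - scst M 2^-1 *: diff0 (y.2 x.1 - x.2 y.1)).

Definition gpair_pc : pcx gsec -> pcx gsec -> pcx A := pc_map2 gpair.
Definition courant_pc : pcx gsec -> pcx gsec -> pcx gsec := pc_map2 courant.
Definition anchor_pc : pcx gsec -> pcx (vfield M) := pc_map fst.

Definition adjoint_of (G H : gsec -> gsec) : Prop :=
  forall x y, gpair (H x) y = gpair x (G y).

End Courant.

Section ParaContact.
Context {R : realType} {n : nat} {M : smooth_manifold R n}.
Local Notation A := (smoothfun M).
Local Notation gsec := (vfield M * oneform M)%type.

Definition form_sharp (s : twoform M) (X : vfield M) : oneform M :=
  @Oneform R n M (fun Y => s X Y) (fun f Y Z => aform_linearr s f Y Z X).

Fact dual_endo_subproof (F : {linear vfield M -> vfield M}) (a : oneform M) f X Y :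
  a (F (f *: X + Y)) = f * a (F X) + a (F Y).
Proof. by rewrite linearP oact_linear. Qed.
Definition dual_endo (F : {linear vfield M -> vfield M}) (a : oneform M) : oneform M :=
  @Oneform R n M (fun X => a (F X)) (dual_endo_subproof F a).

Context (Z : vfield M) (xi : oneform M).
Context (pi : bivector M) (sigma : twoform M) (F : {linear vfield M -> vfield M}).

Definition gendo (x : gsec) : gsec :=
  (F x.1 + biv_sharp pi x.2, form_sharp sigma x.1 - dual_endo F x.2).

Definition odot (x : gsec) : gsec := (xi x.1 *: Z, x.2 Z *: xi).

Record gen_almost_para_contact : Prop := {
  gac_adjoint : adjoint_of gendo (fun x => - gendo x);
  gac_norm : xi Z = 1;
  gac_xi : gendo (0, xi) = 0;
  gac_Z : gendo (Z, 0) = 0;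
  gac_square : forall x, gendo (gendo x) = x - odot x }.

Definition ker_sum : set gsec := [set x : gsec | x.2 Z = 0 /\ xi x.1 = 0].

Definition E10 : set (pcx gsec) := [set Pc x (gendo x) | x in ker_sum].
Definition E01 : set (pcx gsec) := [set Pc x (- gendo x) | x in ker_sum].

Definition line_bundle (x : gsec) : set (pcx gsec) :=
  [set f *: pc_real x | f in [set: pcx A]].

Definition bundle_sum (S T : set (pcx gsec)) : set (pcx gsec) :=
  [set u + v | u in S & v in T].

Definition bundleL : set (pcx gsec) := bundle_sum (line_bundle (Z, 0)) E10.
Definition bundleLstar : set (pcx gsec) := bundle_sum (line_bundle (0, xi)) E01.

Definition gen_para_contact : Prop :=
  gen_almost_para_contact /\
  forall u v, bundleL u -> bundleL v -> bundleL (courant_pc u v).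

Definition type_1_1 (w : twoform M) : Prop :=
  (forall u v, E10 u -> E10 v -> pc_map2 w (anchor_pc u) (anchor_pc v) = 0) /\
  (forall u v, E01 u -> E01 v -> pc_map2 w (anchor_pc u) (anchor_pc v) = 0).

End ParaContact.

(* Main.v *)
Require Import Defs.
From mathcomp Require Import all_boot all_order all_algebra.
From mathcomp Require Import all_classical all_reals all_analysis.
From mathcomp Require Import ring.
Set Implicit Arguments.
Unset Strict Implicit.
Unset Printing Implicit Defensive.
Import GRing.Theory Num.Theory.
Local Open Scope ring_scope.

(* The paracomplex numbers are [R * R], so every identity of the Courant
   algebroid [TM + T^*M] extends to its paracomplexification componentwise. By
   the theorem of Liu, Weinstein and Xu, a pair of transversal isotropic
   subbundles closed under the Courant bracket is a Lie bialgebroid. Since [L]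
   is closed by assumption, everything amounts to the closedness of [L^*].
   Conjugating the closedness of [L], brackets of sections of [E01] lie in
   [L_Z + E01], and their coefficient on [Z] is [- d xi] evaluated on the
   anchors; the remaining brackets follow since [<[u, v], t>] is trilinear and
   totally skew on [L^*]. *)

(** * The Dorfman bracket on sections of $TM + T^*M$ *)

Section DorfmanBracket.
Context {R : realType} {n : nat} {M : smooth_manifold R n}.
Local Notation A := (smoothfun M).
Local Notation vf := (vfield M).
Local Notation form1 := (oneform M).
Local Notation gsec := (vfield M * oneform M)%type.
Implicit Types (X Y W : vf) (f g : A) (u v w : form1) (x y z : gsec).

Lemma scst_halfK : scst M 2^-1 * 2 = 1.
Proof.
have -> : (2 : A) = scst M 2 by apply: val_inj; apply/funext.
by apply: val_inj; apply/funext => p; apply: mulVf; rewrite pnatr_eq0.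
Qed.

Lemma scst_half_double f : scst M 2^-1 * f + scst M 2^-1 * f = f.
Proof.
by rewrite -mulrDl -mulr2n -(mulr_natr (scst M 2^-1)) scst_halfK mul1r.
Qed.

(** The constant function 1/2 inverts 2 in the ring of smooth functions, so none of its modules has
    2-torsion. *)
Lemma addrr_eq0 (V : lmodType A) (v : V) : v + v = 0 -> v = 0.
Proof.
rewrite -mulr2n -scaler_nat => v0.
by rewrite -[v]scale1r -scst_halfK -scalerA v0 scaler0.
Qed.

Lemma vact_scst X c : X (scst M c) = 0.
Proof.
have X1 : X 1 = 0.
  have := vactM X 1 1; rewrite !mul1r mulr1 => /(congr1 (fun h => h - X 1)).
  by rewrite addrK subrr.
by rewrite -[scst M c]mulr1 vactZ X1 mulr0.
Qed.

Lemma vf_jacobi X Y W : vf_bracket X (vf_bracket Y W) =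
  vf_bracket (vf_bracket X Y) W + vf_bracket Y (vf_bracket X W).
Proof. by apply: vfieldP => f /=; rewrite !(vactD, vactN); ring. Qed.

(** The bracket $[X,Y] + L_X\beta - i_Y d\alpha$, a non-skew companion of the Courant bracket that
    satisfies the Leibniz rule and the Jacobi identity with no correction terms. *)
Definition dorfman x y : gsec :=
  (vf_bracket x.1 y.1, lieD x.1 y.2 - form_sharp (diff1 x.2) y.1).

Definition diff_sec f : gsec := (0, diff0 f).

Lemma gpairC x y : gpair x y = gpair y x.
Proof. by rewrite /gpair addrC. Qed.

Lemma gpairDl x y z : gpair (x + y) z = gpair x z + gpair y z.
Proof. by rewrite /gpair /= oactD; ring. Qed.

Lemma gpairZl f x y : gpair (f *: x) y = f * gpair x y.
Proof. by rewrite /gpair /= oactZ; ring. Qed.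

(** A vector field is determined by its action on functions, so pairing with exact forms $df$
    detects the vector part; pairing with vector fields detects the form. *)
Lemma gpair_nondeg x : (forall y, gpair x y = 0) -> x = 0.
Proof.
have gp0 y : gpair x y = 0 -> y.2 x.1 + x.2 y.1 = 0.
  move=> e; by rewrite -[LHS]scst_half_double -/(gpair x y) e addr0.
move=> x0; rewrite [x]surjective_pairing; congr pair.
  apply: vfieldP => f; have := gp0 (diff_sec f) (x0 _).
  by rewrite /= oact0 addr0.
by apply: oneformP => X; have := gp0 (X, 0) (x0 _); rewrite /= add0r.
Qed.

Lemma diff1Dl u X Y W :
  diff1_fun u (X + Y) W = diff1_fun u X W + diff1_fun u Y W.
Proof. by have := diff1_linearl u 1 X Y W; rewrite scale1r mul1r. Qed.

Lemma diff1Zl u f X W : diff1_fun u (f *: X) W = f * diff1_fun u X W.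
Proof.
have d0 : diff1_fun u 0 W = 0.
  by apply: (addrI (diff1_fun u 0 W)); rewrite -diff1Dl !addr0.
by have := diff1_linearl u f X 0 W; rewrite !addr0 d0 addr0.
Qed.

Lemma dorfmanDr x y z : dorfman x (y + z) = dorfman x y + dorfman x z.
Proof.
congr pair; first by apply: vfieldP => f /=; rewrite vactD; ring.
by apply: oneformP => W /=; rewrite vactD diff1Dl; ring.
Qed.

Lemma dorfmanDl x y z : dorfman (y + z) x = dorfman y x + dorfman z x.
Proof.
have brD X Y W : vf_bracket (X + Y) W = vf_bracket X W + vf_bracket Y W.
  by apply: vfieldP => f /=; rewrite vactD; ring.
congr pair; first exact: brD.
apply: oneformP => W /=; rewrite /diff1_fun /= brD !(vactD, oactD).
by ring.
Qed.

Lemma dorfman_leibniz f x y :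
  dorfman x (f *: y) = f *: dorfman x y + x.1 f *: y.
Proof.
congr pair; first by apply: vfieldP => g /=; rewrite vactM; ring.
by apply: oneformP => W /=; rewrite vactM diff1Zl; ring.
Qed.

(** The symmetric part of the bracket is exact, with the pairing as potential; on orthogonal
    sections the bracket is therefore skew. *)
Lemma dorfman_sym x y :
  dorfman x y + dorfman y x = diff_sec (gpair x y + gpair x y).
Proof.
congr pair; first by apply: vfieldP => f /=; ring.
have -> : gpair x y + gpair x y = y.2 x.1 + x.2 y.1.
  exact: scst_half_double.
apply: oneformP => W /=; rewrite /diff1_fun /= vactD; ring.
Qed.

(** The Courant bracket is the skew part of the Dorfman bracket, so the two agree on orthogonal
    sections. *)
Lemma courantE x y : courant x y = dorfman x y - diff_sec (gpair x y).
Proof.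
congr pair; first by rewrite subr0.
apply: oneformP => W /=; rewrite /gpair vactZ /diff1_fun !(vactD, vactN).
have := scst_half_double (W (x.2 y.1)); set b := W (x.2 y.1) => e.
by rewrite -{2}e; ring.
Qed.

Lemma gpair_diff_sec f x : gpair (diff_sec (f + f)) x = x.1 f.
Proof.
by rewrite /gpair /= oact0 add0r vactD mulrDr scst_half_double.
Qed.

Lemma vact_gpair x y z :
  x.1 (gpair y z) = gpair (dorfman x y) z + gpair y (dorfman x z).
Proof.
rewrite /gpair vactZ !vactD /= /diff1_fun.
by rewrite (vf_bracketC z.1 y.1) oactN; ring.
Qed.

Lemma dorfman_jacobi x y z : dorfman x (dorfman y z) =
  dorfman (dorfman x y) z + dorfman y (dorfman x z).
Proof.
congr pair; first exact: vf_jacobi.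
apply: oneformP => W /=; rewrite /diff1_fun /= /diff1_fun.
rewrite !(vactD, vactN, oactD, oactN) /=.
have e u X Y Z : u (vf_bracket X (vf_bracket Y Z)) =
    u (vf_bracket (vf_bracket X Y) Z) + u (vf_bracket Y (vf_bracket X Z)).
  by rewrite vf_jacobi oactD.
(* Once the Jacobi identity of vector fields is used under each of the three one-forms, only a
   commutative ring identity remains. *)
rewrite (e z.2 x.1 y.1 W) (e y.2 x.1 z.1 W) (e x.2 y.1 z.1 W).
ring.
Qed.

End DorfmanBracket.

(** * Idempotent components of a paracomplexification *)

Section ParacomplexComponents.
(* [R[e]] is [R * R] through the idempotents [(1 + e)/2] and [(1 - e)/2]: the
   paracomplex extension of any biadditive operation acts separately on the
   two components [u + v] and [u - v] of [u + e v]. *)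
Definition pc_comp {V : zmodType} (b : bool) (x : pcx V) : V :=
  if b then pre x - pim x else pre x + pim x.

Context {V : zmodType}.
Implicit Types (x y : pcx V).

Lemma pc_compD b x y : pc_comp b (x + y) = pc_comp b x + pc_comp b y.
Proof. by case: b; rewrite /= ?opprD addrACA. Qed.

Lemma pc_comp0 b : pc_comp b (0 : pcx V) = 0.
Proof. by case: b; rewrite /= ?oppr0 addr0. Qed.

Lemma pc_compN b x : pc_comp b (- x) = - pc_comp b x.
Proof. by case: b; rewrite /= -opprD. Qed.

Lemma pc_comp_real b (v : V) : pc_comp b (pc_real v) = v.
Proof. by case: b; rewrite /= ?oppr0 addr0. Qed.

Lemma pc_comp_map (W : zmodType) (h : V -> W) b x :
  (forall u v, h (u + v) = h u + h v) ->
  pc_comp b (pc_map h x) = h (pc_comp b x).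
Proof.
move=> hD; have h0 : h 0 = 0 by apply: (addrI (h 0)); rewrite -hD !addr0.
have hN v : h (- v) = - h v by apply: (addrI (h v)); rewrite -hD !subrr.
by case: b; rewrite /= ?hD ?hN.
Qed.

(** Biadditivity is all that is assumed of [h], so that brackets and derivatives, which are not
    linear over functions, are covered too. *)
Lemma pc_comp_map2 (U W : zmodType) (h : V -> U -> W) b x (y : pcx U) :
  (forall u v w, h (u + v) w = h u w + h v w) ->
  (forall u v w, h u (v + w) = h u v + h u w) ->
  pc_comp b (pc_map2 h x y) = h (pc_comp b x) (pc_comp b y).
Proof.
move=> hDl hDr.
have h0l u : h 0 u = 0 by apply: (addrI (h 0 u)); rewrite -hDl !addr0.
have h0r u : h u 0 = 0 by apply: (addrI (h u 0)); rewrite -hDr !addr0.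
have hNl u v : h (- u) v = - h u v.
  by apply: (addrI (h u v)); rewrite -hDl !subrr.
have hNr u v : h u (- v) = - h u v.
  by apply: (addrI (h u v)); rewrite -hDr !subrr.
case: b; rewrite /= !(hDl, hDr, hNl, hNr) ?opprK ?opprD.
  by rewrite addrACA [- _ + _]addrC -addrACA [- _ + _]addrC.
by rewrite addrACA [h (pim x) (pim y) + _]addrC -addrACA.
Qed.

End ParacomplexComponents.

(** * The paracomplexified Courant algebroid *)

Section ParacomplexCourant.
Context {R : realType} {n : nat} {M : smooth_manifold R n}.
Local Notation A := (smoothfun M).
Local Notation C := (pcx A).
Local Notation gsec := (vfield M * oneform M)%type.
Local Notation E := (pcx gsec).
Implicit Types (f g : C) (x y z : E) (X Y : pcx (vfield M)).

(** The components $u+v$ and $u-v$ determine $2u$ and $2v$, and there is no 2-torsion. *)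
Lemma pc_comp_inj (V : lmodType A) (x y : pcx V) :
  (forall b, pc_comp b x = pc_comp b y) -> x = y.
Proof.
move=> xy; apply/eqP; rewrite -subr_eq0; apply/eqP.
have c0 b : pc_comp b (x - y) = pc_comp b 0.
  by rewrite pc_compD pc_compN xy subrr pc_comp0.
case: (x - y) c0 => u v uv.
have /eqP : u + v = 0 by rewrite -[LHS]/(pc_comp false (Pc u v)) uv pc_comp0.
have : u - v = 0 by rewrite -[LHS]/(pc_comp true (Pc u v)) uv pc_comp0.
rewrite addr_eq0 => /[swap] /eqP ->; rewrite -opprD => /eqP.
by rewrite oppr_eq0 => /eqP /addrr_eq0 ->; rewrite oppr0.
Qed.

Lemma pc_comp_inj_fun f g : (forall b, pc_comp b f = pc_comp b g) -> f = g.
Proof. exact: (@pc_comp_inj A^o). Qed.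

Lemma pc_addrr_eq0 (V : lmodType A) (x : pcx V) : x + x = 0 -> x = 0.
Proof.
case: x => u v; case => /addrr_eq0 -> /addrr_eq0 ->.
by [].
Qed.

Lemma pc_addrr_eq0_fun f : f + f = 0 -> f = 0.
Proof. exact: (@pc_addrr_eq0 A^o). Qed.

Definition dorfman_pc : E -> E -> E := pc_map2 dorfman.
Definition diff_pc : C -> E := pc_map diff_sec.

Lemma diff_secD (f g : A) : diff_sec (f + g) = diff_sec f + diff_sec g.
Proof.
congr pair; first by rewrite addr0.
by apply: oneformP => X /=; rewrite vactD.
Qed.

Lemma gpairDr (x y z : gsec) : gpair z (x + y) = gpair z x + gpair z y.
Proof. by rewrite !(gpairC z) gpairDl. Qed.

Lemma pc_comp_scale (V : lmodType A) b f (x : pcx V) :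
  pc_comp b (f *: x) = pc_comp b f *: pc_comp b x.
Proof. by apply: pc_comp_map2 => *; rewrite (scalerDl, scalerDr). Qed.

Lemma pc_comp_mul b f g : pc_comp b (f * g) = pc_comp b f * pc_comp b g.
Proof. by apply: pc_comp_map2 => *; rewrite (mulrDl, mulrDr). Qed.

Lemma pc_comp_gpair b x y :
  pc_comp b (gpair_pc x y) = gpair (pc_comp b x) (pc_comp b y).
Proof. by apply: pc_comp_map2 => *; rewrite (gpairDl, gpairDr). Qed.

Lemma pc_comp_dorfman b x y :
  pc_comp b (dorfman_pc x y) = dorfman (pc_comp b x) (pc_comp b y).
Proof. by apply: pc_comp_map2 => *; rewrite (dorfmanDl, dorfmanDr). Qed.

Lemma pc_comp_diff b f : pc_comp b (diff_pc f) = diff_sec (pc_comp b f).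
Proof. by apply: pc_comp_map => *; rewrite diff_secD. Qed.

Lemma pc_comp_anchor b x : pc_comp b (anchor_pc x) = (pc_comp b x).1.
Proof. exact: pc_comp_map. Qed.

Lemma pc_comp_vact b X f :
  pc_comp b (vact_pc X f) = pc_comp b X (pc_comp b f).
Proof. by apply: pc_comp_map2 => *; rewrite ?vactD. Qed.

(** Rewriting with this list turns a paracomplex identity into its real counterpart on each
    component. *)
Definition pc_compE := (@pc_compD, @pc_comp0, @pc_compN, @pc_comp_real,
  pc_comp_scale, pc_comp_mul, pc_comp_gpair, pc_comp_dorfman, pc_comp_diff,
  pc_comp_anchor, pc_comp_vact).

Lemma gpair_pcC x y : gpair_pc x y = gpair_pc y x.
Proof. by apply: pc_comp_inj_fun => b; rewrite !pc_compE gpairC. Qed.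

Lemma gpair_pcDl x y z : gpair_pc (x + y) z = gpair_pc x z + gpair_pc y z.
Proof. by apply: pc_comp_inj_fun => b; rewrite !pc_compE gpairDl. Qed.

Lemma gpair_pc0l x : gpair_pc 0 x = 0.
Proof. by apply: (addrI (gpair_pc 0 x)); rewrite -gpair_pcDl !addr0. Qed.

Lemma gpair_pcZl f x y : gpair_pc (f *: x) y = f * gpair_pc x y.
Proof. by apply: pc_comp_inj_fun => b; rewrite !pc_compE gpairZl. Qed.

Lemma gpair_pcDr x y z : gpair_pc z (x + y) = gpair_pc z x + gpair_pc z y.
Proof. by rewrite !(gpair_pcC z) gpair_pcDl. Qed.

Lemma gpair_pcZr f x y : gpair_pc y (f *: x) = f * gpair_pc y x.
Proof. by rewrite !(gpair_pcC y) gpair_pcZl. Qed.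

Lemma gpair_pcNl x y : gpair_pc (- x) y = - gpair_pc x y.
Proof. by rewrite -scaleN1r gpair_pcZl mulN1r. Qed.

Lemma gpair_pcNr x y : gpair_pc x (- y) = - gpair_pc x y.
Proof. by rewrite !(gpair_pcC x) gpair_pcNl. Qed.

Lemma gpair_pc0r x : gpair_pc x 0 = 0.
Proof. by rewrite gpair_pcC gpair_pc0l. Qed.

Lemma gpair_pc_nondeg x : (forall y, gpair_pc x y = 0) -> x = 0.
Proof.
move=> x0; apply: pc_comp_inj => b; rewrite pc_comp0; apply: gpair_nondeg => y.
by rewrite -[y](pc_comp_real b) -pc_comp_gpair x0 pc_comp0.
Qed.

Lemma dorfman_pcDr x y z :
  dorfman_pc x (y + z) = dorfman_pc x y + dorfman_pc x z.
Proof. by apply: pc_comp_inj => b; rewrite !pc_compE dorfmanDr. Qed.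

Lemma dorfman_pcNr x y : dorfman_pc x (- y) = - dorfman_pc x y.
Proof.
have d0 : dorfman_pc x 0 = 0.
  by apply: (addrI (dorfman_pc x 0)); rewrite -dorfman_pcDr !addr0.
by apply: (addrI (dorfman_pc x y)); rewrite -dorfman_pcDr !subrr.
Qed.

Lemma dorfman_pc_leibniz f x y :
  dorfman_pc x (f *: y) = f *: dorfman_pc x y + vact_pc (anchor_pc x) f *: y.
Proof. by apply: pc_comp_inj => b; rewrite !pc_compE dorfman_leibniz. Qed.

Lemma dorfman_pc_sym x y :
  dorfman_pc x y + dorfman_pc y x = diff_pc (gpair_pc x y + gpair_pc x y).
Proof. by apply: pc_comp_inj => b; rewrite !pc_compE dorfman_sym. Qed.

Lemma gpair_diff_pc f x :
  gpair_pc (diff_pc (f + f)) x = vact_pc (anchor_pc x) f.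
Proof. by apply: pc_comp_inj_fun => b; rewrite !pc_compE gpair_diff_sec. Qed.

Lemma diff_pc0 : diff_pc 0 = 0.
Proof.
apply: pc_comp_inj => b; rewrite !pc_compE.
congr pair; apply: oneformP => X; exact: vact0.
Qed.

Lemma vact_gpair_pc x y z : vact_pc (anchor_pc x) (gpair_pc y z) =
  gpair_pc (dorfman_pc x y) z + gpair_pc y (dorfman_pc x z).
Proof. by apply: pc_comp_inj_fun => b; rewrite !pc_compE vact_gpair. Qed.

Lemma dorfman_pc_jacobi x y z : dorfman_pc x (dorfman_pc y z) =
  dorfman_pc (dorfman_pc x y) z + dorfman_pc y (dorfman_pc x z).
Proof. by apply: pc_comp_inj => b; rewrite !pc_compE dorfman_jacobi. Qed.

Lemma courant_pcE x y :
  courant_pc x y = dorfman_pc x y - diff_pc (gpair_pc x y).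
Proof.
by apply: pcxP; rewrite /= !courantE diff_secD opprD addrACA.
Qed.

Lemma courant_pc_orthogonal x y :
  gpair_pc x y = 0 -> courant_pc x y = dorfman_pc x y.
Proof. by rewrite courant_pcE => ->; rewrite diff_pc0 subr0. Qed.

Lemma dorfman_pc_skew x y :
  gpair_pc x y = 0 -> dorfman_pc x y = - dorfman_pc y x.
Proof.
move=> xy0; have := dorfman_pc_sym x y; rewrite xy0 addr0 diff_pc0.
by move/eqP; rewrite addr_eq0 => /eqP.
Qed.

Lemma vact_pc0 X : vact_pc X 0 = 0.
Proof. by apply: pc_comp_inj_fun => b; rewrite !pc_compE vact0. Qed.

Lemma vact_pc_cst X c : vact_pc X (pc_cst c) = 0.
Proof.
by apply: pcxP; rewrite /= !vact_scst addr0.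
Qed.

End ParacomplexCourant.

(** * Isotropic subbundles, Lie algebroids and Lie bialgebroids *)

Section DiracStructures.
Context {R : realType} {n : nat} {M : smooth_manifold R n}.
Local Notation C := (pcx (smoothfun M)).
Local Notation E := (pcx (vfield M * oneform M)).
Implicit Types (S T : set E) (f g : C) (x y z a b : E).

Record isotropic_submodule S : Prop := {
  iso_zero : S 0;
  iso_submod : forall f x y, S x -> S y -> S (f *: x + y);
  iso_orth : forall x y, S x -> S y -> gpair_pc x y = 0 }.

Definition courant_closed S : Prop :=
  forall x y, S x -> S y -> S (courant_pc x y).

Lemma isoZ S f x : isotropic_submodule S -> S x -> S (f *: x).
Proof.
move=> iS Sx; rewrite -[_ *: _]addr0.
by apply: iso_submod => //; exact: iso_zero.
Qed.

Lemma courant_isotropic S x y : isotropic_submodule S -> S x -> S y ->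
  courant_pc x y = dorfman_pc x y.
Proof. by move=> iS Sx Sy; rewrite courant_pc_orthogonal// (iso_orth iS). Qed.

(** On an isotropic [S] the Courant and Dorfman brackets coincide and are skew, so the Leibniz form
    of the Jacobi identity becomes the cyclic one. *)
Lemma isotropic_lie_algebroid S : isotropic_submodule S -> courant_closed S ->
  lie_algebroid S courant_pc anchor_pc.
Proof.
move=> iS cS; have ce := courant_isotropic iS; have SZ := isoZ _ iS.
have SL := iso_submod iS.
have alt x : S x -> dorfman_pc x x = 0.
  move=> Sx; apply: pc_addrr_eq0.
  by rewrite dorfman_pc_sym (iso_orth iS) // addr0 diff_pc0.
have skew x y : S x -> S y -> dorfman_pc x y = - dorfman_pc y x.
  by move=> Sx Sy; apply: dorfman_pc_skew; exact: (iso_orth iS).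
have linr c x y z : S x -> S y -> S z -> dorfman_pc z (pc_cst c *: x + y) =
    pc_cst c *: dorfman_pc z x + dorfman_pc z y.
  move=> Sx Sy Sz.
  by rewrite dorfman_pcDr dorfman_pc_leibniz vact_pc_cst scale0r addr0.
split=> //.
- exact: iso_zero.
- move=> c x y z Sx Sy Sz; rewrite !ce//; last exact: SL.
  rewrite skew//; last exact: SL.
  by rewrite linr// opprD -scalerN -!skew.
- by move=> c x y z Sx Sy Sz; rewrite !ce ?linr//; exact: SL.
- by move=> x Sx; rewrite ce ?alt.
- move=> x y z Sx Sy Sz; have cS' u v : S u -> S v -> S (dorfman_pc u v).
    by move=> Su Sv; rewrite -ce//; exact: cS.
  rewrite (ce y z)// (ce z x)// (ce x y)//.
  rewrite (ce _ _ Sx (cS' _ _ Sy Sz)) (ce _ _ Sy (cS' _ _ Sz Sx)).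
  rewrite (ce _ _ Sz (cS' _ _ Sx Sy)) (skew _ _ Sz (cS' _ _ Sx Sy)).
  by rewrite dorfman_pc_jacobi (skew z x)// dorfman_pcNr addrK subrr.
- move=> f x y Sx Sy; rewrite !ce ?dorfman_pc_leibniz//; exact: SZ.
Qed.

(* For transversal isotropic [S] and [T] the pairing is a duality, and
   [d_* y (a, b) = - <dorfman y a, b>], so the compatibility condition is the
   Jacobi identity of the Dorfman bracket paired with a section of [T]. *)
Theorem transversal_lie_bialgebroid S T :
  isotropic_submodule S -> isotropic_submodule T ->
  courant_closed S -> courant_closed T ->
  (forall u, exists s t, [/\ S s, T t & u = s + t]) ->
  lie_bialgebroid S courant_pc anchor_pc T courant_pc anchor_pc gpair_pc.
Proof.
move=> iS iT cS cT split_ST.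
have nondegS x : S x -> (forall a, T a -> gpair_pc x a = 0) -> x = 0.
  move=> Sx x0; apply: gpair_pc_nondeg => u.
  have [s [t [Ss Tt ->]]] := split_ST u.
  by rewrite gpair_pcDr (x0 t)// (iso_orth iS)// addr0.
have nondegT a : T a -> (forall x, S x -> gpair_pc x a = 0) -> a = 0.
  move=> Ta a0; apply: gpair_pc_nondeg => u.
  have [s [t [Ss Tt ->]]] := split_ST u.
  by rewrite gpair_pcC gpair_pcDl (a0 s)// (iso_orth iT)// addr0.
(* By invariance of the pairing and isotropy of [S], the [T] component of [dorfman_pc x a] satisfies
   the condition defining $L_x a$. Nondegeneracy makes it the only solution, so [xget] returns it
   rather than the default 0. *)
have dualE x a t : S x -> T a -> T t ->
    (exists2 s, S s & dorfman_pc x a = s + t) ->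
    dual_lie S courant_pc anchor_pc T gpair_pc x a = t.
  move=> Sx Ta Tt [s Ss xa].
  have tP y : S y -> gpair_pc y t =
      vact_pc (anchor_pc x) (gpair_pc y a) - gpair_pc (courant_pc x y) a.
    move=> Sy; rewrite vact_gpair_pc (courant_isotropic iS)// xa gpair_pcDr.
    by rewrite (iso_orth iS Sy Ss) add0r [RHS]addrAC subrr add0r.
  apply: xget_unique; first by split.
  move=> t' [Tt' t'P]; apply/eqP; rewrite -subr_eq0; apply/eqP; apply: nondegT.
    by rewrite addrC -scaleN1r; exact: iso_submod.
  by move=> y Sy; rewrite gpair_pcDr gpair_pcNr t'P// -tP// subrr.
have dstarE y a b : T a -> T b -> dstar courant_pc anchor_pc gpair_pc y a b =
    - gpair_pc (dorfman_pc y a) b.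
  move=> Ta Tb; rewrite /dstar /cochain_diff (courant_isotropic iT)//.
  (* The derivative of $\langle y,a\rangle$ along $b$ is the pairing of $b$ with the symmetric part
     of the bracket of $a$ and $y$. *)
  rewrite vact_gpair_pc -gpair_diff_pc -(gpair_pcC a y) -dorfman_pc_sym.
  by rewrite gpair_pcDl; ring.
split; try exact: isotropic_lie_algebroid.
  by split=> // *; rewrite ?gpair_pcDl ?gpair_pcDr ?gpair_pcZl ?gpair_pcZr.
move=> x y a b Sx Sy Ta Tb; rewrite /lie_bivec.
have decomp z c : S z -> T c -> exists s t, [/\ S s, T t,
    dorfman_pc z c = s + t &
    dual_lie S courant_pc anchor_pc T gpair_pc z c = t].
  move=> Sz Tc; have [s [t [Ss Tt e]]] := split_ST (dorfman_pc z c).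
  by exists s, t; split=> //; apply: dualE => //; exists s.
have [xas [xat [Sxa Txa xaE ->]]] := decomp x a Sx Ta.
have [xbs [xbt [Sxb Txb xbE ->]]] := decomp x b Sx Tb.
have [yas [yat [Sya Tya yaE ->]]] := decomp y a Sy Ta.
have [ybs [ybt [Syb Tyb ybE ->]]] := decomp y b Sy Tb.
rewrite !dstarE// (courant_isotropic iS)//.
have vactN X f : vact_pc X (- f) = - vact_pc X f.
  by apply: pc_comp_inj_fun => c; rewrite !pc_compE vactN.
rewrite !vactN !vact_gpair_pc (dorfman_pc_jacobi x y a) gpair_pcDl.
(* Isotropy of [T] makes $\langle t,b\rangle$ constant 0, which transfers the bracket with [z] from
   [t] to [b]. The terms left beside the Jacobi identity pair [S] components with [T] components and
   cancel. *)
have move_T z t : T t ->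
    gpair_pc (dorfman_pc z t) b = - gpair_pc t (dorfman_pc z b).
  move=> Tt; apply/eqP; rewrite -addr_eq0 -vact_gpair_pc (iso_orth iT)//.
  by rewrite vact_pc0.
rewrite (move_T x yat)// (move_T y xat)// xaE xbE yaE ybE.
rewrite !(gpair_pcDl, gpair_pcDr) (iso_orth iS Sya Sxb) (iso_orth iS Sxa Syb).
rewrite (iso_orth iT Tya Txb) (iso_orth iT Txa Tyb); ring.
Qed.

End DiracStructures.

(** * Paracomplex conjugation, which exchanges the two components *)

Section Conjugation.
Context {R : realType} {n : nat} {M : smooth_manifold R n}.
Local Notation C := (pcx (smoothfun M)).
Local Notation E := (pcx (vfield M * oneform M)).

Definition pc_conj {V : zmodType} (x : pcx V) : pcx V := Pc (pre x) (- pim x).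

Lemma pc_comp_conj (V : zmodType) b (x : pcx V) :
  pc_comp b (pc_conj x) = pc_comp (~~ b) x.
Proof. by case: b; rewrite /= ?opprK. Qed.

Lemma pc_conjK (V : zmodType) : involutive (@pc_conj V).
Proof. by move=> [u v]; rewrite /pc_conj /= opprK. Qed.

Lemma pc_conj_linear (V : lmodType (smoothfun M)) (f : C) (x y : pcx V) :
  pc_conj (f *: x + y) = pc_conj f *: pc_conj x + pc_conj y.
Proof.
by apply: pc_comp_inj => b; rewrite !(pc_comp_conj, pc_compE).
Qed.

Lemma pc_conj_dorfman (x y : E) :
  pc_conj (dorfman_pc x y) = dorfman_pc (pc_conj x) (pc_conj y).
Proof. by apply: pc_comp_inj => b; rewrite !(pc_comp_conj, pc_compE). Qed.

Lemma pc_comp_form (w : twoform M) b (X Y : pcx (vfield M)) :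
  pc_comp b (pc_map2 w X Y) = w (pc_comp b X) (pc_comp b Y).
Proof.
apply: pc_comp_map2 => u v t.
  by have := aform_linearl w 1 u v t; rewrite scale1r mul1r.
by have := aform_linearr w 1 v t u; rewrite scale1r mul1r.
Qed.

Lemma pc_conj_form (w : twoform M) (u v : E) :
  pc_map2 w (anchor_pc (pc_conj u)) (anchor_pc (pc_conj v)) =
  pc_conj (pc_map2 w (anchor_pc u) (anchor_pc v)).
Proof.
by apply: pc_comp_inj_fun => b; rewrite !(pc_comp_conj, pc_comp_form, pc_compE).
Qed.

End Conjugation.

Lemma scale_axis_add (K : pzRingType) (V : lmodType K) (h f g : K) (p u v : V) :
  h *: (f *: p + u) + (g *: p + v) = (h * f + g) *: p + (h *: u + v).
Proof. by rewrite scalerDl scalerDr scalerA addrACA. Qed.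

(** * Eigenbundles of a generalized almost para-contact structure *)

Section ParaContactStructures.
Context {R : realType} {n : nat} {M : smooth_manifold R n}.
Local Notation A := (smoothfun M).
Local Notation C := (pcx A).
Local Notation gsec := (vfield M * oneform M)%type.
Local Notation E := (pcx gsec).
Context (Z : vfield M) (xi : oneform M) (pi : bivector M) (sigma : twoform M)
  (F : {linear vfield M -> vfield M}).
Context (hF : gen_almost_para_contact Z xi pi sigma F).
Implicit Types (f g c : C) (u v p : E) (w : gsec).

Local Notation Phi := (gendo pi sigma F).
Local Notation zeta := (pc_real (Z, 0 : oneform M)).
Local Notation eta := (pc_real (0 : vfield M, xi)).

(** The record [bivector] does not state linearity of [biv_sharp]; it follows from that of the
    bivector by pairing with exact forms. *)
Lemma gendo_linear (f : A) w w' : Phi (f *: w + w') = f *: Phi w + Phi w'.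
Proof.
have sharp_lin (a b : oneform M) :
    biv_sharp pi (f *: a + b) = f *: biv_sharp pi a + biv_sharp pi b.
  apply: vfieldP => g.
  have e d : biv_sharp pi d g = biv pi d (diff0 g) := biv_sharpE pi d (diff0 g).
  by rewrite /= !e aform_linearl.
congr pair => /=.
  by rewrite linearP sharp_lin scalerDr addrACA.
by apply: oneformP => X /=; rewrite aform_linearl; ring.
Qed.

Lemma gendoD w w' : Phi (w + w') = Phi w + Phi w'.
Proof. by have := gendo_linear 1 w w'; rewrite !scale1r. Qed.

Lemma gendo0 : Phi 0 = 0.
Proof. by apply: (addrI (Phi 0)); rewrite -gendoD !addr0. Qed.

Lemma gendoZ (f : A) w : Phi (f *: w) = f *: Phi w.
Proof. by have := gendo_linear f w 0; rewrite !addr0 gendo0 addr0. Qed.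

Lemma gendoN w : Phi (- w) = - Phi w.
Proof. by rewrite -scaleN1r gendoZ scaleN1r. Qed.

Lemma gendo_skew w w' : gpair (Phi w) w' = - gpair w (Phi w').
Proof.
by rewrite -(gac_adjoint hF) -scaleN1r gpairZl mulN1r opprK.
Qed.

Lemma gpair_Z w : gpair w (Z, 0) + gpair w (Z, 0) = w.2 Z.
Proof. by rewrite /gpair /= add0r scst_half_double. Qed.

Lemma gpair_xi w : gpair w (0, xi) + gpair w (0, xi) = xi w.1.
Proof. by rewrite /gpair /= oact0 addr0 scst_half_double. Qed.

(* [e] times the paracomplex extension of [gendo], so that [E10] and [E01] are
   its eigenbundles for [1] and [-1]. *)
Definition egendo u : E := Pc (Phi (pim u)) (Phi (pre u)).

Lemma pc_comp_egendo b u :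
  pc_comp b (egendo u) = (if b then -1 else 1) *: Phi (pc_comp b u).
Proof.
by case: b; rewrite ?scaleN1r ?scale1r /= gendoD ?gendoN ?opprB // addrC.
Qed.

Lemma egendo_linear f u v : egendo (f *: u + v) = f *: egendo u + egendo v.
Proof.
apply: pc_comp_inj => b; rewrite !(pc_comp_egendo, pc_compE) gendo_linear.
by rewrite scalerDr !scalerA [in LHS]mulrC.
Qed.

Lemma egendoD u v : egendo (u + v) = egendo u + egendo v.
Proof. by have := egendo_linear 1 u v; rewrite !scale1r. Qed.

Lemma egendoZ f u : egendo (f *: u) = f *: egendo u.
Proof.
have e0 : egendo 0 = 0 by apply: (addrI (egendo 0)); rewrite -egendoD !addr0.
by have := egendo_linear f u 0; rewrite !addr0 e0 addr0.
Qed.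

Lemma egendo_skew u v : gpair_pc (egendo u) v = - gpair_pc u (egendo v).
Proof.
apply: pc_comp_inj_fun => b; rewrite !(pc_comp_egendo, pc_compE).
rewrite gpairZl gendo_skew [in RHS]gpairC gpairZl mulrN.
by rewrite (gpairC _ (pc_comp b u)).
Qed.

Lemma egendo_zeta : egendo zeta = 0.
Proof. by rewrite /egendo /= gendo0 (gac_Z hF). Qed.

Lemma egendo_eta : egendo eta = 0.
Proof. by rewrite /egendo /= gendo0 (gac_xi hF). Qed.

(** The coordinate along [zeta], equal to $\xi$ on the anchor: the pairing is doubled because
    $\langle\zeta,\eta\rangle = 1/2$. *)
Definition zeta_coef u : C := gpair_pc u eta + gpair_pc u eta.
Definition eta_coef u : C := gpair_pc u zeta + gpair_pc u zeta.

Lemma egendo_square u :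
  egendo (egendo u) = u - (zeta_coef u *: zeta + eta_coef u *: eta).
Proof.
apply: pc_comp_inj => b; rewrite !(pc_comp_egendo, pc_compE) gendoZ scalerA.
have -> : (if b then -1 else 1) * (if b then -1 else 1) = 1 :> A.
  by case: b; rewrite ?mulrNN mulr1.
rewrite scale1r (gac_square hF) gpair_Z gpair_xi; congr (_ - _).
congr pair => /=; first by rewrite scaler0 addr0.
by rewrite scaler0 add0r.
Qed.

(** One family contains $L$ ([zeta], 1), $L^*$ ([eta], -1) and the conjugate of $L$ ([zeta], -1). *)
Definition eigensum p c : set E :=
  [set u | exists f v, egendo v = c *: v /\ u = f *: p + v]%classic.

Lemma eigen_orth p c v : c * c = 1 -> egendo p = 0 -> egendo v = c *: v ->
  gpair_pc v p = 0.
Proof.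
move=> cc Gp Gv; rewrite -[LHS]mul1r -cc -mulrA -gpair_pcZl -Gv egendo_skew Gp.
by rewrite gpair_pc0r oppr0 mulr0.
Qed.

Lemma eigensum_isotropic p c : c * c = 1 -> egendo p = 0 ->
  gpair_pc p p = 0 -> isotropic_submodule (eigensum p c).
Proof.
move=> cc Gp pp; split.
- exists 0, 0; split; last by rewrite scale0r addr0.
  by rewrite scaler0 -[X in egendo X](scale0r 0) egendoZ scale0r.
- move=> h _ _ [f [u [Gu ->]]] [g [v [Gv ->]]].
  exists (h * f + g), (h *: u + v); split.
    by rewrite egendo_linear Gu Gv scalerDr !scalerA mulrC.
  exact: scale_axis_add.
- move=> _ _ [f [u [Gu ->]]] [g [v [Gv ->]]].
  (* Skewness of [egendo] equates $c\langle u,v\rangle$ with its opposite. *)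
  have uv : c * gpair_pc u v = 0.
    apply: pc_addrr_eq0_fun.
    by rewrite -{1}gpair_pcZl -gpair_pcZr -Gu -Gv egendo_skew addNr.
  rewrite !(gpair_pcDl, gpair_pcDr, gpair_pcZl, gpair_pcZr) pp.
  rewrite (gpair_pcC p v) (eigen_orth cc Gp Gu) (eigen_orth cc Gp Gv).
  by rewrite -[gpair_pc u v]mul1r -cc -mulrA uv !(mulr0, addr0).
Qed.

Lemma eigensum_eigen p c v : egendo v = c *: v -> eigensum p c v.
Proof. by move=> Gv; exists 0, v; rewrite scale0r add0r. Qed.

Lemma eigensum_axis p c : eigensum p c p.
Proof.
exists 1, 0; rewrite scale1r addr0 scaler0 -[X in egendo X](scale0r 0).
by rewrite egendoZ scale0r.
Qed.

Lemma gpair_zeta_zeta : gpair_pc zeta zeta = 0.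
Proof.
apply: pc_comp_inj_fun => b; rewrite !pc_compE /gpair /=.
by rewrite addr0 mulr0.
Qed.

Lemma gpair_eta_eta : gpair_pc eta eta = 0.
Proof.
apply: pc_comp_inj_fun => b; rewrite !pc_compE /gpair /= oact0.
by rewrite addr0 mulr0.
Qed.

Lemma sqr1 : 1 * 1 = 1 :> C. Proof. by rewrite mulr1. Qed.
Lemma sqrN1 : -1 * -1 = 1 :> C. Proof. by rewrite mulrNN mulr1. Qed.

Lemma ker_sum_gendo w : ker_sum Z xi w -> Phi (Phi w) = w.
Proof.
by case=> w2 w1; rewrite (gac_square hF) /odot w1 w2 !scale0r subr0.
Qed.

(** The endomorphism is skew and kills $Z$ and $\xi$, so its image is orthogonal to both. *)
Lemma gendo_ker_sum w : ker_sum Z xi (Phi w).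
Proof.
have g0 w' : gpair w' (0 : gsec) = 0.
  by rewrite gpairC -(scale0r 0) gpairZl mul0r.
split.
  by rewrite -gpair_Z gendo_skew (gac_Z hF) g0 oppr0 addr0.
by rewrite -gpair_xi gendo_skew (gac_xi hF) g0 oppr0 addr0.
Qed.

(** The eigenvalue equation puts both parts of [v] in the image of [gendo], hence in [ker_sum]. *)
Lemma E10P v : E10 Z xi pi sigma F v <-> egendo v = 1 *: v.
Proof.
rewrite scale1r; split=> [[w /ker_sum_gendo kw <-]|].
  by rewrite /egendo /= kw.
move=> Gv; have e : Phi (pim v) = pre v := congr1 (@pre gsec) Gv.
have e' : Phi (pre v) = pim v := congr1 (@pim gsec) Gv.
exists (pre v); first by rewrite -e; exact: gendo_ker_sum.
by apply: pcxP.
Qed.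

Lemma E01P v : E01 Z xi pi sigma F v <-> egendo v = -1 *: v.
Proof.
rewrite scaleN1r; split=> [[w /ker_sum_gendo kw <-]|].
  by rewrite /egendo /= gendoN kw; apply: pcxP => //=; rewrite opprK.
move=> Gv; have e : Phi (pim v) = - pre v := congr1 (@pre gsec) Gv.
have e' : Phi (pre v) = - pim v := congr1 (@pim gsec) Gv.
exists (pre v); last by apply: pcxP => //; rewrite -[RHS]opprK -e'.
by rewrite -[pre v]opprK -e -gendoN; exact: gendo_ker_sum.
Qed.

Lemma bundleLE : bundleL Z xi pi sigma F = eigensum zeta 1.
Proof.
apply/seteqP; split => u.
  by move=> [_ [f _ <-] [v /E10P Gv <-]]; exists f, v.
move=> [f [v [/E10P Gv ->]]]; exists (f *: zeta); first by exists f.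
by exists v.
Qed.

Lemma bundleLstarE : bundleLstar Z xi pi sigma F = eigensum eta (-1).
Proof.
apply/seteqP; split => u.
  by move=> [_ [f _ <-] [v /E01P Gv <-]]; exists f, v.
move=> [f [v [/E01P Gv ->]]]; exists (f *: eta); first by exists f.
by exists v.
Qed.

(** With $G$ = [egendo], $G^3 = G$. Hence $(G^2+G)/2$ and $(G^2-G)/2$ map onto the eigenbundles for
    1 and -1, and $u - G^2u$ is the part along [zeta] and [eta]. *)
Lemma eigensum_split u :
  exists s t, [/\ eigensum zeta 1 s, eigensum eta (-1) t & u = s + t].
Proof.
pose h : C := Pc (scst M 2^-1) 0.
have hD x : h *: x + h *: x = x :> E.
  rewrite -scalerDl (_ : h + h = 1) ?scale1r//.
  have := scst_half_double (1 : A); rewrite !mulr1 => hh.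
  by apply: pcxP; rewrite /= ?addr0.
have G3 : egendo (egendo (egendo u)) = egendo u.
  rewrite [LHS]egendo_square /zeta_coef /eta_coef !egendo_skew.
  by rewrite egendo_zeta egendo_eta gpair_pc0r oppr0 addr0 !scale0r addr0 subr0.
exists (zeta_coef u *: zeta + h *: (egendo (egendo u) + egendo u)).
exists (eta_coef u *: eta + h *: (egendo (egendo u) - egendo u)); split.
- exists (zeta_coef u); eexists; split; last by [].
  by rewrite scale1r egendoZ egendoD G3 addrC.
- exists (eta_coef u); eexists; split; last by [].
  by rewrite egendoZ -scaleN1r egendoD egendoZ G3 !scaleN1r -scalerN opprB.
rewrite addrACA -scalerDr addrACA subrr addr0 scalerDr hD egendo_square.
by rewrite addrC subrK.
Qed.

(** * The form $d\xi$ and the closedness of $L^*$ *)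

Lemma dxi_dorfman u v :
  pc_map2 (diff1 xi) (anchor_pc u) (anchor_pc v) =
  vact_pc (anchor_pc u) (zeta_coef v) - vact_pc (anchor_pc v) (zeta_coef u)
    - zeta_coef (dorfman_pc u v).
Proof.
by apply: pc_comp_inj_fun => b; rewrite !(pc_comp_form, pc_compE) !gpair_xi.
Qed.

(** Eigenvectors are orthogonal to [eta], so of the three terms of $d\xi$ only the bracket
    survives. *)
Lemma dxi_dorfman_eigen c u v :
  c * c = 1 -> egendo u = c *: u -> egendo v = c *: v ->
  pc_map2 (diff1 xi) (anchor_pc u) (anchor_pc v) =
  - (gpair_pc (dorfman_pc u v) eta + gpair_pc (dorfman_pc u v) eta).
Proof.
move=> cc Gu Gv; rewrite dxi_dorfman /zeta_coef.
rewrite (eigen_orth cc egendo_eta Gu) (eigen_orth cc egendo_eta Gv).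
by rewrite addr0 !vact_pc0 subrr sub0r.
Qed.

(** Conjugation changes the sign of the factor $e$ in [egendo]. *)
Lemma egendo_conj u c : egendo u = c *: u ->
  egendo (pc_conj u) = - pc_conj c *: pc_conj u.
Proof.
move=> Gu; rewrite scaleNr -[_ *: pc_conj u]addr0.
have <- : pc_conj (0 : E) = 0 by apply: pcxP; rewrite //= oppr0.
rewrite -pc_conj_linear addr0 -Gu.
by apply: pcxP; rewrite /= ?gendoN ?opprK.
Qed.

Lemma pc_conj1 : pc_conj 1 = 1 :> C.
Proof. by apply: pcxP; rewrite //= oppr0. Qed.

Lemma pc_conjN1 : pc_conj (-1) = -1 :> C.
Proof. by apply: pcxP; rewrite //= !oppr0. Qed.

(* The conjugate of [L] is [eigensum zeta (-1)]. *)
Lemma dorfman_E01 u v : courant_closed (eigensum zeta 1) ->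
  egendo u = -1 *: u -> egendo v = -1 *: v ->
  eigensum zeta (-1) (dorfman_pc u v).
Proof.
move=> cL Gu Gv; have iL := eigensum_isotropic sqr1 egendo_zeta gpair_zeta_zeta.
have toL t : egendo t = -1 *: t -> eigensum zeta 1 (pc_conj t).
  move=> /egendo_conj; rewrite pc_conjN1 opprK; exact: eigensum_eigen.
have cz : pc_conj zeta = zeta by apply: pcxP; rewrite //= oppr0.
have := cL _ _ (toL _ Gu) (toL _ Gv).
rewrite (courant_isotropic iL (toL _ Gu) (toL _ Gv)) -pc_conj_dorfman.
case=> f [t [Gt /(congr1 pc_conj)]]; rewrite pc_conjK pc_conj_linear cz => ->.
exists (pc_conj f), (pc_conj t); split=> //.
by rewrite (egendo_conj Gt) pc_conj1.
Qed.

Lemma eigensum_zeta_isotropic c :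
  c * c = 1 -> isotropic_submodule (eigensum zeta c).
Proof.
move=> cc; apply: eigensum_isotropic => //.
  exact: egendo_zeta.
exact: gpair_zeta_zeta.
Qed.

Lemma eigensum_eta_isotropic c :
  c * c = 1 -> isotropic_submodule (eigensum eta c).
Proof.
move=> cc; apply: eigensum_isotropic => //.
  exact: egendo_eta.
exact: gpair_eta_eta.
Qed.

(** Maximality of $L^*$: the $L$ component of such a [u] is orthogonal to $L^*$ by assumption and to
    $L$ by isotropy, hence zero. *)
Lemma eigensum_eta_lagrangian u :
  (forall t, eigensum eta (-1) t -> gpair_pc u t = 0) -> eigensum eta (-1) u.
Proof.
have iL := eigensum_zeta_isotropic sqr1.
have iT := eigensum_eta_isotropic sqrN1.
have [s [t [Ls Tt ->]]] := eigensum_split u.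
move=> st0; suff -> : s = 0 by rewrite add0r.
apply: gpair_pc_nondeg => y; have [s' [t' [Ls' Tt' ->]]] := eigensum_split y.
have := st0 _ Tt'; rewrite gpair_pcDl (iso_orth iT Tt Tt') addr0.
rewrite gpair_pcDr => ->.
by rewrite (iso_orth iL Ls Ls') addr0.
Qed.

(* On the isotropic [L^*] the trilinear form [<dorfman u v, t>] is totally
   skew, hence it vanishes as soon as it does on the generators. *)
Lemma eigensum_eta_closed :
  courant_closed (eigensum zeta 1) ->
  (forall u v, egendo u = -1 *: u -> egendo v = -1 *: v ->
    pc_map2 (diff1 xi) (anchor_pc u) (anchor_pc v) = 0) ->
  courant_closed (eigensum eta (-1)).
Proof.
move=> cL dxi0; have iT := eigensum_eta_isotropic sqrN1.
have Te : eigensum eta (-1) eta by exact: eigensum_axis.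
have Tv v : egendo v = -1 *: v -> eigensum eta (-1) v by exact: eigensum_eigen.
have skew12 x y t : eigensum eta (-1) x -> eigensum eta (-1) y ->
    gpair_pc (dorfman_pc x y) t = - gpair_pc (dorfman_pc y x) t.
  by move=> Tx Ty; rewrite dorfman_pc_skew ?gpair_pcNl// (iso_orth iT).
have skew23 x y t : eigensum eta (-1) y -> eigensum eta (-1) t ->
    gpair_pc (dorfman_pc x y) t = - gpair_pc (dorfman_pc x t) y.
  move=> Ty Tt; apply/eqP; rewrite -addr_eq0 (gpair_pcC (dorfman_pc x t)).
  by rewrite -vact_gpair_pc (iso_orth iT Ty Tt) vact_pc0.
have axisZ x y t f : eigensum eta (-1) y -> eigensum eta (-1) t ->
    gpair_pc (dorfman_pc x (f *: y)) t = f * gpair_pc (dorfman_pc x y) t.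
  move=> Ty Tt; rewrite dorfman_pc_leibniz gpair_pcDl !gpair_pcZl.
  by rewrite (iso_orth iT Ty Tt) mulr0 addr0.
have uv_eta u v : egendo u = -1 *: u -> egendo v = -1 *: v ->
    gpair_pc (dorfman_pc u v) eta = 0.
  move=> Gu Gv; apply: pc_addrr_eq0_fun; apply: oppr_inj.
  by rewrite -(dxi_dorfman_eigen sqrN1 Gu Gv) dxi0// oppr0.
(* The [eta] part of [t] is handled by the assumption on $d\xi$; for the rest, the bracket and [t']
   both lie in the isotropic conjugate of $L$. *)
have uvt u v t : egendo u = -1 *: u -> egendo v = -1 *: v ->
    eigensum eta (-1) t -> gpair_pc (dorfman_pc u v) t = 0.
  move=> Gu Gv [h [t' [Gt' ->]]].
  rewrite gpair_pcDr gpair_pcZr uv_eta// mulr0 add0r.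
  apply: (iso_orth (eigensum_zeta_isotropic sqrN1)).
    exact: (dorfman_E01 cL Gu Gv).
  exact: eigensum_eigen.
(* Skewness in the last two arguments kills the value at [eta], [eta] and moves the remaining [eta]
   to the last place. *)
have ue_t u t : egendo u = -1 *: u -> eigensum eta (-1) t ->
    gpair_pc (dorfman_pc u eta) t = 0.
  move=> Gu [h [t' [Gt' ->]]].
  have ee : gpair_pc (dorfman_pc u eta) eta = 0.
    by apply: pc_addrr_eq0_fun; rewrite {1}(skew23 _ _ _ Te Te) addNr.
  rewrite gpair_pcDr gpair_pcZr ee mulr0 add0r (skew23 _ _ _ Te (Tv _ Gt')).
  by rewrite (uvt _ _ _ Gu Gt' Te) oppr0.
have uTT u y t : egendo u = -1 *: u -> eigensum eta (-1) y ->
    eigensum eta (-1) t -> gpair_pc (dorfman_pc u y) t = 0.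
  move=> Gu [g [v [Gv ->]]] Tt; rewrite dorfman_pcDr gpair_pcDl.
  rewrite (axisZ _ _ _ _ Te Tt) (ue_t _ _ Gu Tt) (uvt _ _ _ Gu Gv Tt).
  by rewrite mulr0 addr0.
have eTT y t : eigensum eta (-1) y -> eigensum eta (-1) t ->
    gpair_pc (dorfman_pc eta y) t = 0.
  move=> [g [v [Gv ->]]] Tt; rewrite dorfman_pcDr gpair_pcDl.
  rewrite (axisZ _ _ _ _ Te Tt) (skew12 _ _ _ Te (Tv _ Gv)).
  rewrite (uTT _ _ _ Gv Te Tt).
  have -> : dorfman_pc eta eta = 0.
    apply: pc_addrr_eq0.
    by rewrite dorfman_pc_sym (iso_orth iT Te Te) addr0 diff_pc0.
  by rewrite gpair_pc0l mulr0 oppr0 addr0.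
move=> x y Tx Ty; rewrite (courant_isotropic iT Tx Ty).
(* Membership in $L^*$ is thus tested by pairing, and splitting [y] reduces to brackets whose first
   argument is [eta] or an eigenvector. *)
apply: eigensum_eta_lagrangian => t Tt.
have [g [v [Gv ->]]] := Ty; rewrite dorfman_pcDr gpair_pcDl.
rewrite (axisZ _ _ _ _ Te Tt) (skew12 _ _ _ Tx Te) (skew12 _ _ _ Tx (Tv _ Gv)).
by rewrite (uTT _ _ _ Gv Tx Tt) (eTT _ _ Tx Tt) oppr0 mulr0 addr0.
Qed.

End ParaContactStructures.

(** * The equivalence *)

Theorem theorem4p2 (R : realType) (n : nat) (odd_n : odd n)
    (M : smooth_manifold R n) (Z : vfield M) (xi : oneform M)
    (pi : bivector M) (sigma : twoform M) (F : {linear vfield M -> vfield M})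
    (hF : gen_para_contact Z xi pi sigma F) :
  lie_bialgebroid
    (bundleL Z xi pi sigma F) courant_pc anchor_pc
    (bundleLstar Z xi pi sigma F) courant_pc anchor_pc
    gpair_pc
  <-> type_1_1 Z xi pi sigma F (diff1 xi).
Proof.
case: hF => hA; rewrite (bundleLE hA) (bundleLstarE hA) => cL.
have iL := eigensum_zeta_isotropic hA (sqr1 (M := M)).
have iT := eigensum_eta_isotropic hA (sqrN1 (M := M)).
split=> [[_ /la_closed cT _ _]|[_ dxi0]]; last first.
  apply: transversal_lie_bialgebroid => //; last exact: (eigensum_split hA).
  apply: (eigensum_eta_closed hA cL) => u v Gu Gv.
  by apply: dxi0; apply/(E01P hA).
have dxi0 u v : egendo pi sigma F u = -1 *: u ->
    egendo pi sigma F v = -1 *: v ->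
    pc_map2 (diff1 xi) (anchor_pc u) (anchor_pc v) = 0.
  move=> Gu Gv; rewrite (dxi_dorfman_eigen hA (sqrN1 (M := M)) Gu Gv).
  have Tu := eigensum_eigen (pc_real (0, xi)) Gu.
  have Tv := eigensum_eigen (pc_real (0, xi)) Gv.
  (* Closedness puts the bracket in $L^*$, which is isotropic and contains [eta]; the formula for
     $d\xi$ then gives 0. *)
  have := cT _ _ Tu Tv; rewrite (courant_isotropic iT Tu Tv) => Tuv.
  rewrite (iso_orth iT Tuv); first by rewrite addr0 oppr0.
  exact: eigensum_axis.
split=> u v; last by move=> /(E01P hA) Gu /(E01P hA) Gv; exact: dxi0.
(* Conjugation sends [E10] to [E01] and $d\xi$ is real, so the (2,0) part follows from the (0,2)
   part. *)
move=> /(E10P hA)/egendo_conj Gu /(E10P hA)/egendo_conj Gv.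
rewrite pc_conj1 in Gu Gv; rewrite -[LHS]pc_conjK -pc_conj_form dxi0//.
by apply: pcxP; rewrite //= oppr0.
Qed.
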